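(* Let $\mathcal{H}\subseteq 2^{\omega}$ be dense-codense. Then for all samples $f:\omega\to\omega$ and all $n\in\omega$, $$S(\mathcal{H},f,n)=S(\mathcal{H}^c,f,n)=0 .$$
   Context: $2^{\omega}$ is the set of functions $\omega\to\{0,1\}$ with the product topology ($\{0,1\}$ discrete). $\mathcal{H}^c=2^\omega\setminus\mathcal{H}$. $\mathcal{H}$ is dense-codense if both $\mathcal{H}$ and $\mathcal{H}^c$ are dense in $2^\omega$. A sample is an injective function $f:\omega\to\omega$. Write $[n]=\{0,\dots,n-1\}$. For $X_0\subseteq\omega$, $\mathcal{H}{\upharpoonright}_{X_0}=\{h{\upharpoonright}_{X_0}: h\in\mathcal{H}\}$. The surprise of $\mathcal{H}$ along $f$ at stage $n$ is $$S(\mathcal{H},f,n)=1-\frac{|\mathcal{H}{\upharpoonright}_{f([n])}|}{2^{|f([n])|}}.$$ *)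

(* Defs.v *)
From mathcomp Require Import all_boot all_order all_algebra finmap.
From mathcomp Require Import boolp classical_sets functions cardinality.
From mathcomp Require Import topology cantor.

Set Implicit Arguments.
Unset Strict Implicit.
Unset Printing Implicit Defensive.

Import GRing.Theory.

Local Open Scope classical_set_scope.
Local Open Scope ring_scope.

Definition dense_codense (H : set cantor_space) : Prop :=
  dense H /\ dense (~` H).

Definition sample (f : nat -> nat) : Prop := injective f.

Definition restr (H : set cantor_space) (X0 : set nat) : set (X0 -> bool) :=
  [set sigL X0 h | h in H].

Arguments restr : clear implicits.

(* [fset_set A] is empty when [A] is infinite; here it is only applied to
   [f @` `I_n] and to a set of functions from [f @` `I_n] to [bool], both
   finite. *)
Definition surprise (H : set cantor_space) (f : nat -> nat) (n : nat) : rat :=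
  1 - #|` fset_set (restr H (f @` `I_n))|%:R
      / 2 ^+ #|` fset_set (f @` `I_n)|.

(* Main.v *)
Require Import Defs.
From mathcomp Require Import all_boot all_order all_algebra finmap.
From mathcomp Require Import mathcomp_extra boolp classical_sets functions cardinality.
From mathcomp Require Import topology cantor.

(** Fixing finitely many coordinates of a point of the Cantor space cuts out a
    nonempty open set, and a dense set meets every such set.  Hence a dense set
    realizes each of the [2 ^ |X|] patterns on a finite set [X] of coordinates
    ([dense_restr]): no pattern is ever ruled out, so the surprise of a dense
    set is 0.  When a set is dense-codense, this applies both to it and to its
    complement. *)

Local Open Scope classical_set_scope.
Local Open Scope ring_scope.

Lemma open_cylinder (X : set nat) (v : cantor_space) : finite_set X ->
  open [set h : cantor_space | forall i, X i -> h i = v i].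
Proof.
move=> finX.
have -> : [set h : cantor_space | forall i, X i -> h i = v i] =
    \bigcap_(i in X) (proj i @^-1` [set v i]).
  by apply/seteqP; split => h /= hv i; exact: hv.
rewrite -bigsetI_fset_set//; apply: big_ind => [|A B|i _].
- exact: openT.
- exact: openI.
- apply: open_comp; last exact: discrete_open.
  by move=> h _; exact: proj_continuous.
Qed.

Lemma dense_restr (H : set cantor_space) (X : set nat) :
  dense H -> finite_set X -> restr H X = setT.
Proof.
move=> dH finX; apply/seteqP; split => // g _.
(* Any extension of [g] to all coordinates will do: the cylinder over [X]
   depends only on [g]. *)
pose v : cantor_space := 'valL_ false g.
have [||h [hv Hh]] := dH [set h : cantor_space | forall i, X i -> h i = v i].
- by exists v.
- exact: open_cylinder.
exists h => //; rewrite -(valLK false g); apply/eq_sigLP => i /set_mem.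
exact: hv.
Qed.

(** The index type of [X -> R] is the subtype of a classical set, not a
    [finType]; reindexing by the elements of [fset_set X] turns these functions
    into finite functions, which [card_ffun] counts. *)
Lemma card_fset_set_fun (T : choiceType) (R : finType) (X : set T) :
  finite_set X ->
  #|` fset_set [set: X -> R]| = (#|R| ^ #|` fset_set X|)%N.
Proof.
move=> finX; set D := fset_set X.
have XD (x : X) : set_val x \in D by rewrite in_fset_set//; exact: valP.
have DX (d : D) : fsval d \in X by rewrite -in_fset_set//; exact: valP.
pose F (g : {ffun D -> R}) : X -> R := fun x => g [` XD x]%fset.
have F_inj : injective F.
  move=> g1 g2 eqF; apply/ffunP => d.
  have := congr1 (@^~ (SigSub (DX d))) eqF; rewrite /F.
  by have -> : [` XD (SigSub (DX d))]%fset = d by exact: val_inj.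
have -> : [set: X -> R] = [set` [fset F g | g in {ffun D -> R}]%fset].
  apply/seteqP; split => // f _ /=; apply/imfsetP.
  exists [ffun d => f (SigSub (DX d))] => //.
  by apply/funext => x; rewrite /F ffunE; congr f; exact: val_inj.
by rewrite set_fsetK card_imfset//= -cardE card_ffun cardfE.
Qed.

Lemma dense_surprise (H : set cantor_space) (f : nat -> nat) (n : nat) :
  dense H -> surprise H f n = 0.
Proof.
move=> dH; have finX : finite_set (f @` `I_n) by exact: finite_image.
rewrite /surprise dense_restr// card_fset_set_fun// card_bool GRing.natrX.
by rewrite GRing.divff ?GRing.subrr// GRing.expf_neq0.
Qed.

Theorem proposition2p5 (H : set cantor_space) (hH : dense_codense H)
    (f : nat -> nat) (hf : sample f) (n : nat) :
  surprise H f n = 0 /\ surprise (~` H) f n = 0.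
Proof. by case: hH => dH dHc; split; exact: dense_surprise. Qed.
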